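(* Let $G$ be a finite group with $m=|G|$. Suppose $A$ is an $n\times n$ matrix over $\mathbb{Z}G$, and let $\eta(t)\in\mathbb{Z}[t]$ be the characteristic polynomial of the $mn\times mn$ integer matrix $\widetilde A$. Then $\eta(A)=0$, and: (1) the finite sequence $(\mathrm{tr}(A^k))_{1\le k\le mn}$ determines $(\mathrm{tr}(A^k))_{1\le k<\infty}$ (i.e. two $n\times n$ matrices over $\mathbb{Z}G$ with the same finite sequence have the same infinite sequence); (2) the finite sequence $(\kappa(\mathrm{tr}(A^k)))_{1\le k\le mn}$ determines $(\kappa(\mathrm{tr}(A^k)))_{1\le k<\infty}$ (in the same sense). Moreover, if $A$ and $B$ are matrices which are strong shift equivalent over $\mathbb{Z}G$, then $(\kappa(\mathrm{tr}(A^k)))_{1\le k<\infty}=(\kappa(\mathrm{tr}(B^k)))_{1\le k<\infty}$.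
   Context: $\mathbb{Z}G$ is the integral group ring. $\kappa:\mathbb{Z}G\to\mathbb{Z}\mathrm{Conj}\,G$ is the additive homomorphism to the free abelian group on the conjugacy classes of $G$ sending $\sum_g n_g g$ to $\sum_g n_g\kappa(g)$, where $\kappa(g)$ is the conjugacy class of $g$. Fix an enumeration $G=\{g_1,\dots,g_m\}$. For $x\in\mathbb{Z}G$ let $\rho(x)$ be the $m\times m$ integer matrix of left multiplication $y\mapsto xy$ on $\mathbb{Z}G\cong\mathbb{Z}^m$ with respect to the basis $g_1,\dots,g_m$. For $A=(a_{ij})$ of size $n\times n$ over $\mathbb{Z}G$, $\widetilde A$ is the $mn\times mn$ integer matrix with $m\times m$ blocks whose $ij$ block is $\rho(a_{ij})$. Square matrices $A,B$ (possibly of different sizes) are elementary strong shift equivalent over a ring $\mathcal R$ if there are matrices $R,S$ over $\mathcal R$ with $A=RS$, $B=SR$; strong shift equivalence over $\mathcal R$ is the transitive closure of this relation. *)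

(* Defs.v *)
From HB Require Import structures.
From mathcomp Require Import all_boot all_order all_algebra all_fingroup.

Set Implicit Arguments.
Unset Strict Implicit.
Unset Printing Implicit Defensive.

Import GRing.Theory.
Local Open Scope ring_scope.

(* The element \sum_g n_g g of the integral group ring is the function
   g |-> n_g.  The alias keeps the convolution product apart from the
   pointwise product that {ffun gT -> int} already carries. *)
Definition int_group_ring (gT : finGroupType) : Type := {ffun gT -> int}.

Notation "'ZG' [ gT ]" := (int_group_ring gT)
  (at level 0, format "'ZG' [ gT ]") : type_scope.

Section IntGroupRing.

Variable gT : finGroupType.

HB.instance Definition _ := GRing.Zmodule.copy ZG[gT] {ffun gT -> int}.

Implicit Types (x y z : ZG[gT]) (g h : gT).

Definition gr_one : ZG[gT] := [ffun g => (g == 1%g)%:R].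

(* \sum_h \sum_k x_h y_k hk; the coefficient of g comes from k = h^-1 g. *)
Definition gr_mul x y : ZG[gT] :=
  [ffun g => \sum_(h : gT) x h * y (h^-1 * g)%g].

Fact gr_mulA : associative gr_mul.
Proof.
move=> x y z; apply/ffunP=> g; rewrite !ffunE.
under eq_bigr => h _ do rewrite ffunE big_distrr /=.
under [RHS]eq_bigr => h _ do rewrite ffunE big_distrl /=.
rewrite [RHS]exchange_big /=; apply: eq_bigr => h _.
rewrite [RHS](reindex_inj (mulgI h)) /=; apply: eq_bigr => k _.
by rewrite mulKg invMg !mulgA mulrA.
Qed.

Fact gr_mul1r : left_id gr_one gr_mul.
Proof.
move=> x; apply/ffunP=> g; rewrite ffunE (bigD1 1%g) //= ffunE eqxx mul1r.
rewrite invg1 mul1g big1 ?addr0 // => h /negPf h1.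
by rewrite ffunE h1 mul0r.
Qed.

Fact gr_mulr1 : right_id gr_one gr_mul.
Proof.
move=> x; apply/ffunP=> g; rewrite ffunE (bigD1 g) //= ffunE mulVg eqxx mulr1.
rewrite big1 ?addr0 // => h /negPf hg.
by rewrite ffunE -eq_mulVg1 hg mulr0.
Qed.

Fact gr_mulDl : left_distributive gr_mul +%R.
Proof.
move=> x y z; apply/ffunP=> g; rewrite !ffunE -big_split /=.
by apply: eq_bigr => h _; rewrite !ffunE mulrDl.
Qed.

Fact gr_mulDr : right_distributive gr_mul +%R.
Proof.
move=> x y z; apply/ffunP=> g; rewrite !ffunE -big_split /=.
by apply: eq_bigr => h _; rewrite !ffunE mulrDr.
Qed.

Fact gr_one_neq0 : gr_one != 0.
Proof. by apply/eqP=> /ffunP/(_ 1%g); rewrite !ffunE eqxx. Qed.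

HB.instance Definition _ := GRing.Zmodule_isNzRing.Build ZG[gT]
  gr_mulA gr_mul1r gr_mulr1 gr_mulDl gr_mulDr gr_one_neq0.

Definition gr_elt g : ZG[gT] := [ffun h => (h == g)%:R].

Lemma gr_elt1 : gr_elt 1%g = 1.
Proof. by []. Qed.

Lemma gr_eltM g h : gr_elt (g * h)%g = gr_elt g * gr_elt h.
Proof.
apply/ffunP=> k; rewrite !ffunE (bigD1 g) //= !ffunE eqxx mul1r big1 ?addr0.
  by rewrite (can2_eq (mulKVg g) (mulKg g)).
by move=> l /negPf lg; rewrite ffunE lg mul0r.
Qed.

Definition conj_class : Type := {C : {set gT} | C \in classes [set: gT]}.
HB.instance Definition _ := Finite.on conj_class.

Definition class_of g : conj_class :=
  Sub (g ^: [set: gT])%g (mem_classes (in_setT g)).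

(* ZConj G, the free abelian group on the finite set of conjugacy classes. *)
Definition ZConj : Type := {ffun conj_class -> int}.
HB.instance Definition _ := GRing.Zmodule.copy ZConj {ffun conj_class -> int}.

Definition conj_elt (C : conj_class) : ZConj := [ffun D => (D == C)%:R].

Definition kappa x : ZConj := \sum_(g : gT) conj_elt (class_of g) *~ x g.

Fact kappa_is_additive : {morph kappa : x y / x - y}.
Proof.
move=> x y; rewrite /kappa -sumrB; apply: eq_bigr => g _.
by rewrite !ffunE mulrzBr.
Qed.
HB.instance Definition _ :=
  GRing.isZmodMorphism.Build ZG[gT] ZConj kappa kappa_is_additive.

(* Matrices act on column vectors: column j holds the coordinates of
   x * enumG j in the basis enumG 0, enumG 1, ... *)
Definition rho (enumG : 'I_#|gT| -> gT) x : 'M[int]_#|gT| :=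
  \matrix_(i, j) (x * gr_elt (enumG j)) (enumG i).

Definition tilde (enumG : 'I_#|gT| -> gT) n (A : 'M[ZG[gT]]_n) :
    'M[int]_(\sum_(i < n) #|gT|) :=
  \mxblock_(i < n, j < n) rho enumG (A i j).

End IntGroupRing.

Definition elementary_sse (R : pzRingType) (n p : nat)
    (A : 'M[R]_n) (B : 'M[R]_p) : Prop :=
  exists (U : 'M[R]_(n, p)) (V : 'M[R]_(p, n)), A = U *m V /\ B = V *m U.

(* The transitive closure of elementary_sse, as a family indexed by the sizes
   because the intermediate matrices may have any size. *)
Inductive strong_shift_equiv (R : pzRingType) :
    forall n p : nat, 'M[R]_n -> 'M[R]_p -> Prop :=
  | sse_elementary n p (A : 'M[R]_n) (B : 'M[R]_p) :
      elementary_sse A B -> strong_shift_equiv A B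
  | sse_trans n p q (A : 'M[R]_n) (B : 'M[R]_p) (C : 'M[R]_q) :
      strong_shift_equiv A B -> strong_shift_equiv B C ->
      strong_shift_equiv A C.

(* Main.v *)
Require Import Defs.
From HB Require Import structures.
From mathcomp Require Import all_boot all_order all_algebra all_fingroup.

Set Implicit Arguments.
Unset Strict Implicit.
Unset Printing Implicit Defensive.

Import GRing.Theory Num.Theory.
Local Open Scope ring_scope.

(** The map A |-> tilde A is an injective ring morphism into integer matrices,
    because rho is the regular representation (rhoM, rho1, rho_inj). Hence the
    Cayley-Hamilton relation of tilde A pulls back to A
    (char_poly_tilde_annihilates). The characteristic polynomial is monic of
    degree N = m n, so the sequence tr(A^k), and its image under any additive
    map f, satisfies a linear recurrence of order N
    (additive_trace_recurrence).

    Two matrices with the same initial segment of f(tr(A^k)) satisfy the same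
    recurrence when f remembers the coefficient of the identity of G. Indeed
    tr(tilde A) is m times that coefficient of tr(A) (mxtrace_tilde), so the
    power traces of tilde A and tilde B agree up to exponent N, and in
    characteristic zero Newton's identities (newton_char_poly) recover the
    characteristic polynomial from them (char_poly_eq_mxtrace). The recurrence
    then propagates the equality, never reaching back to the exponent 0
    (additive_trace_determined). Both f = id and f = kappa qualify, the latter
    because the identity is alone in its conjugacy class (kappa_class1).

    For shift equivalence, hk and kh are conjugate, so kappa(xy) = kappa(yx).
    Thus kappa o tr is cyclic on rectangular products over the
    noncommutative ring ZG (kappa_mxtrace_mulC), and (UV)^k and (VU)^k have
    the same image.

    Newton's identities and the Cayley-Hamilton relation both come from the
    coefficients of t adj(t - A): they obey a one-step recursion whose
    solution is the sequence of tails of the characteristic polynomial,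
    shifted down and evaluated at A (adj_coefE), while the trace of adj(t - A) is the derivative of the
    characteristic polynomial (deriv_char_poly). *)

(** * Newton's identities *)

Section NewtonIdentities.

Variable R : comNzRingType.

Lemma deriv_prod_seq (I : eqType) (r : seq I) (F : I -> {poly R}) :
  uniq r ->
  (\prod_(i <- r) F i)^`() =
  \sum_(i <- r) (F i)^`() * \prod_(j <- r | i != j) F j.
Proof.
elim: r => [|i r IHr] /=; first by rewrite !big_nil derivC.
case/andP=> r'i /IHr{}IHr; rewrite !big_cons derivM IHr eqxx /=.
have neq_i j : j \in r -> i != j by apply: contraTneq => <-.
congr (_ * _ + _).
  by rewrite big_seq_cond [RHS]big_seq_cond; apply: eq_bigl => j;
     case: (boolP (j \in r)) => //= /neq_i->.
rewrite big_distrr /= big_seq [RHS]big_seq; apply: eq_bigr => j /neq_i.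
by rewrite eq_sym big_cons => ->; rewrite mulrCA.
Qed.

Lemma deriv_prod (I : finType) (F : I -> {poly R}) :
  (\prod_i F i)^`() = \sum_i (F i)^`() * \prod_(j | i != j) F j.
Proof. exact: deriv_prod_seq (index_enum_uniq I). Qed.

(** Jacobi's formula: differentiating one factor in each term of the Leibniz
    expansion and grouping the permutations by the image of its row leaves the
    cofactors. *)
Lemma deriv_det n (M : 'M[{poly R}]_n) :
  (\det M)^`() = \sum_i \sum_j (M i j)^`() * cofactor M i j.
Proof.
rewrite /determinant raddf_sum /=.
under eq_bigr => s _.
  rewrite -signr_odd mulr_sign (fun_if (fun p : {poly R} => p^`())) derivN.
  rewrite -mulr_sign signr_odd deriv_prod big_distrr /=.
  over.
rewrite exchange_big /=; apply: eq_bigr => i _.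
rewrite (partition_big (fun s : 'S_n => s i) xpredT) //=.
apply: eq_bigr => j _; rewrite expand_cofactor big_distrr /=.
by apply: eq_bigr => s /eqP->; rewrite mulrCA.
Qed.

Lemma deriv_char_poly n (A : 'M[R]_n) :
  (char_poly A)^`() = \tr (\adj (char_poly_mx A)).
Proof.
rewrite deriv_det; apply: eq_bigr => i _; rewrite [RHS]mxE (bigD1 i) //=.
rewrite !mxE eqxx derivB derivC derivX subr0 mul1r big1 ?addr0 // => j.
by rewrite eq_sym !mxE => /negPf->; rewrite derivB !derivC subr0 mul0r.
Qed.

(** The coefficient of t^j in t adj(t - A). The extra factor t shifts the index
    so that the lowest coefficient is 0, which lets the relation from t^0 take
    the same form as the others. *)
Definition adj_coef n (A : 'M[R]_n) j : 'M[R]_n :=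
  map_mx (coefp j) ('X *: \adj (char_poly_mx A)).

(** Compare coefficients in t adj(t - A) = det(t - A) + A adj(t - A). *)
Lemma adj_coef_rec n (A : 'M[R]_n) j :
  adj_coef A j = (char_poly A)`_j *: 1%:M + A *m adj_coef A j.+1.
Proof.
have/matrixP adjE : 'X *: \adj (char_poly_mx A) =
    (char_poly A)%:M + map_mx polyC A *m \adj (char_poly_mx A).
  rewrite -mul_mx_adj -mulmxDl -mul_scalar_mx.
  by rewrite /char_poly_mx subrK.
apply/matrixP=> i k; rewrite [LHS]mxE adjE !mxE /= coefD coef_sum.
rewrite coefMn mulr_natr; congr (_ + _); apply: eq_bigr => l _.
by rewrite !mxE /= coefCM coefXM.
Qed.

(** Unrolling the recursion far enough that the remainder involves only
    vanishing coefficients of the adjugate. *)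
Lemma adj_coefE n (A : 'M[R]_n) j :
  adj_coef A j = \sum_(i < n.+1) (char_poly A)`_(j + i) *: A ^+ i.
Proof.
have iterE d : adj_coef A j =
    \sum_(i < d) (char_poly A)`_(j + i) *: A ^+ i + A ^+ d *m adj_coef A (j + d).
  elim: d j => [|d IHd] j; first by rewrite big_ord0 addn0 add0r mul1mx.
  rewrite adj_coef_rec IHd big_ord_recl /= addn0 expr0 -addrA mulmxDr.
  rewrite addnS exprS mulmxA addSn; congr (_ + (_ + _)).
  rewrite mulmx_sumr; apply: eq_bigr => i _.
  by rewrite -scalemxAr -addSnnS exprS.
pose M := 'X *: \adj (char_poly_mx A).
pose D := (\max_i \max_k size (M i k))%N.
(* D exceeds the degree of every entry of t adj(t - A); the terms with
   i > n vanish because the characteristic polynomial has degree n. *)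
rewrite (iterE (n.+1 + D)%N) big_split_ord /= [X in _ + X + _]big1 => [|i _].
  suff -> : adj_coef A (j + (n.+1 + D)) = 0 by rewrite mulmx0 !addr0.
  apply/matrixP=> i k; rewrite mxE [RHS]mxE; apply/leq_sizeP: (leqnn (j + (n.+1 + D))).
  rewrite addnA (leq_trans _ (leq_addl _ _)) //.
  rewrite (leq_trans _ (leq_bigmax i)) //.
  exact: (leq_bigmax (F := fun k => size (M i k)) k).
by rewrite nth_default ?scale0r // size_char_poly addnCA leq_addr.
Qed.

(** The case j = 0 of the previous lemma. In this form the relation holds in
    every dimension, also for dimensions that are not syntactically
    successors, such as the size of tilde A. *)
Lemma Cayley_Hamilton_sum n (A : 'M[R]_n) :
  \sum_(i < n.+1) (char_poly A)`_i *: A ^+ i = 0.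
Proof.
rewrite -(adj_coefE A 0); apply/matrixP=> i j.
by rewrite !mxE /= coefXM.
Qed.

(** Both sides are the trace of the coefficient of t^j in t adj(t - A), the left
    one by t tr(adj(t - A)) = t (det(t - A))'. *)
Lemma newton_char_poly n (A : 'M[R]_n) j :
  (char_poly A)`_j *+ j =
  \sum_(i < n.+1) (char_poly A)`_(j + i) * \tr (A ^+ i).
Proof.
transitivity (\tr (adj_coef A j)).
  transitivity ('X * (char_poly A)^`())`_j.
    by rewrite coefXM; case: j => // j; rewrite coef_deriv.
  rewrite deriv_char_poly big_distrr coef_sum; apply: eq_bigr => i _.
  by rewrite !mxE.
by rewrite adj_coefE raddf_sum; apply: eq_bigr => i _; rewrite /= mxtraceZ.
Qed.

End NewtonIdentities.

(** Newton's identities give (n - j) c_j in terms of the coefficients above c_j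
    and the power traces; descend from the leading coefficient 1. *)
Lemma char_poly_eq_mxtrace (R : numDomainType) n (A B : 'M[R]_n) :
  (forall k, (1 <= k <= n)%N -> \tr (A ^+ k) = \tr (B ^+ k)) ->
  char_poly A = char_poly B.
Proof.
move=> trAB; suff eqm m j : (n < j + m)%N ->
    (char_poly A)`_j = (char_poly B)`_j.
  by apply/polyP=> j; apply: (eqm n.+1); rewrite leq_addl.
elim: m j => [|m IHm] j.
  by rewrite addn0 => lt_nj; rewrite !nth_default ?size_char_poly.
(* The induction is on m; the only new index is j = n - m. *)
rewrite addnS ltnS leq_eqVlt => /predU1P[def_n|/IHm//].
case: m => [|m] in IHm def_n *.
  have lead (C : 'M[R]_n) : (char_poly C)`_j = 1 :> R.
    have /monicP := char_poly_monic C.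
    by rewrite lead_coefE size_char_poly /= (_ : j = n) // def_n addn0.
  by rewrite !lead.
(* The term i = 0 is n c_j = (j + (m + 1)) c_j; cancel the j c_j. *)
have newton (C : 'M[R]_n) : (char_poly C)`_j *+ m.+1 =
    - \sum_(i < n) (char_poly C)`_(j + i.+1) * \tr (C ^+ i.+1).
  apply/eqP; rewrite -addr_eq0; apply/eqP.
  apply: (addrI ((char_poly C)`_j *+ j)).
  rewrite addr0 [RHS]newton_char_poly big_ord_recl expr0 addn0 addrA -mulrnDr.
  by rewrite -def_n mxtrace1 mulr_natr.
apply: (pmulrnI (ltn0Sn m)); rewrite (newton A) (newton B).
congr (- _); apply: eq_bigr => i _.
have lt_n : (n < j + i.+1 + m.+1)%N.
  by rewrite addnAC -def_n addnS ltnS leq_addr.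
by rewrite (IHm _ lt_n) (trAB i.+1 (ltn_ord i)).
Qed.

(** * Conjugacy classes and strong shift equivalence *)

Section IntGroupRing.

Variable gT : finGroupType.
Implicit Types (x y : ZG[gT]) (g h : gT).

(** Evaluation at a class, named so that it can carry its additive structure. *)
Definition zconj_coef (C : conj_class gT) (u : ZConj gT) : int := u C.

Fact zconj_coef_is_additive C : {morph zconj_coef C : u v / u - v}.
Proof. by move=> u v; rewrite /zconj_coef !ffunE. Qed.
HB.instance Definition _ C :=
  GRing.isZmodMorphism.Build (ZConj gT) int (zconj_coef C)
    (zconj_coef_is_additive C).

(** The identity is the only element of its conjugacy class, so kappa keeps its
    coefficient. *)
Lemma kappa_class1 x : kappa x (class_of 1%g) = x 1%g.
Proof.
pose C1 := class_of (1%g : gT).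
have coef_elt C n : zconj_coef C1 (conj_elt C *~ n) = (C1 == C)%:R *~ n.
  transitivity (zconj_coef C1 (conj_elt C) *~ n); first exact: raddfMz.
  by congr (_ *~ n); apply: ffunE.
transitivity (\sum_g zconj_coef C1 (conj_elt (class_of g) *~ x g)).
  exact: (raddf_sum (zconj_coef C1)).
rewrite (bigD1 1%g) // big1 => [|g g1]; last first.
  rewrite coef_elt; case: eqP => [/(congr1 val)/= eq1g|_]; last exact: mul0rz.
  case/eqP: g1; apply/set1gP; rewrite -(class1G [set: gT]%G) eq1g.
  exact: class_refl.
by rewrite coef_elt eqxx intz; apply: addr0.
Qed.

Lemma kappa_mulE x y :
  kappa (x * y) =
  \sum_(g : gT) \sum_(h : gT) conj_elt (class_of (g * h)%g) *~ (x g * y h).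
Proof.
rewrite /kappa; under eq_bigr => g _ do rewrite ffunE mulrz_sumr.
rewrite [LHS]exchange_big.
apply: eq_bigr => h _.
rewrite [LHS](reindex_inj (mulgI h)).
by apply: eq_bigr => k _; rewrite mulKg.
Qed.

(** kh is the conjugate of hk by h. *)
Lemma class_of_mulC g h : class_of (g * h)%g = class_of (h * g)%g.
Proof.
apply: val_inj; rewrite /= -(classGidl (h * g)%g (in_setT h)).
by rewrite conjgE mulgA mulKg.
Qed.

Lemma kappa_mulC x y : kappa (x * y) = kappa (y * x).
Proof.
rewrite !kappa_mulE exchange_big /=; apply: eq_bigr => g _.
by apply: eq_bigr => h _; rewrite class_of_mulC mulrC.
Qed.

(** The usual proof of the cyclicity of the trace, with kappa making the entries
    commute. *)
Lemma kappa_mxtrace_mulC n p (U : 'M[ZG[gT]]_(n, p)) (V : 'M_(p, n)) :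
  kappa (\tr (U *m V)) = kappa (\tr (V *m U)).
Proof.
rewrite /mxtrace !raddf_sum /=.
under eq_bigr => i _ do rewrite mxE raddf_sum.
under [RHS]eq_bigr => i _ do rewrite mxE raddf_sum.
rewrite exchange_big /=; apply: eq_bigr => i _.
by apply: eq_bigr => j _; apply: kappa_mulC.
Qed.

Lemma expr_mulmx_shift (R : pzRingType) n p
    (U : 'M[R]_(n, p)) (V : 'M_(p, n)) k :
  (U *m V) ^+ k.+1 = U *m (V *m U) ^+ k *m V.
Proof.
elim: k => [|k IHk]; first by rewrite mulmx1.
by rewrite exprS IHk [in RHS]exprS -mulmxE !mulmxA.
Qed.

Lemma kappa_trace_sse n p (A : 'M[ZG[gT]]_n) (B : 'M[ZG[gT]]_p) :
  strong_shift_equiv A B -> forall k, (1 <= k)%N ->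
  kappa (\tr (A ^+ k)) = kappa (\tr (B ^+ k)).
Proof.
move=> AB; elim: {n p A B}AB => [n p A B [U [V [-> ->]]]|n p q A B C _ AB _ BC].
  case=> // k _; rewrite expr_mulmx_shift -mulmxA kappa_mxtrace_mulC -mulmxA.
  by rewrite exprSr.
by move=> k k_gt0; rewrite AB ?BC.
Qed.

(** * The regular representation *)

Variable (enumG : 'I_#|gT| -> gT).

(** Right multiplication by h permutes coefficients; this makes the entries of
    rho(x) explicit. *)
Lemma gr_mul_elt x g h : (x * gr_elt h) g = x (g * h^-1)%g.
Proof.
rewrite ffunE (bigD1 (g * h^-1)%g) //= ffunE invMg invgK mulgKV eqxx mulr1.
rewrite big1 ?addr0 // => k; rewrite ffunE.
have [<-|_ _] := eqVneq (k^-1 * g)%g h; last by rewrite mulr0.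
by rewrite invMg invgK mulKVg eqxx.
Qed.

Lemma rhoE x i j : rho enumG x i j = x (enumG i * (enumG j)^-1)%g.
Proof. by rewrite mxE gr_mul_elt. Qed.

(** The diagonal entries of rho(x) are all the coefficient of the identity. *)
Lemma mxtrace_rho x : \tr (rho enumG x) = x 1%g *+ #|gT|.
Proof.
rewrite /mxtrace; under eq_bigr => i _ do rewrite rhoE mulgV.
by rewrite sumr_const card_ord.
Qed.

Fact tilde_is_additive n : {morph @tilde gT enumG n : A B / A - B}.
Proof. by move=> A B; apply/matrixP=> i j; rewrite !mxE !gr_mul_elt !ffunE. Qed.
HB.instance Definition _ n :=
  GRing.isZmodMorphism.Build 'M[ZG[gT]]_n 'M[int]_(\sum_(i < n) #|gT|)
    (@tilde gT enumG n) (@tilde_is_additive n).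

Lemma mxtrace_tilde n (A : 'M[ZG[gT]]_n) :
  \tr (tilde enumG A) = \tr A 1%g *+ #|gT|.
Proof.
rewrite mxtrace_mxblock; under eq_bigr => i _ do rewrite mxtrace_rho.
by rewrite sumrMnl /mxtrace sum_ffunE.
Qed.

Hypothesis enumG_bij : bijective enumG.

Lemma rhoM x y : rho enumG (x * y) = rho enumG x *m rho enumG y.
Proof.
apply/matrixP=> i j; rewrite rhoE ffunE mxE.
under [RHS]eq_bigr => k _ do rewrite !rhoE.
(* In the convolution, split the group element by h = g_i g_k^-1. *)
rewrite (reindex (fun k => enumG i * (enumG k)^-1)%g) /=.
  by apply: eq_bigr => k _; rewrite invMg invgK mulgA mulgKV.
have [f fK Kf] := enumG_bij.
exists (fun h => f (h^-1 * enumG i)%g) => [k _|h _].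
  by rewrite invMg invgK mulgKV fK.
by rewrite Kf invMg invgK mulKVg.
Qed.

Lemma rho1 : rho enumG 1 = 1%:M.
Proof.
apply/matrixP=> i j; rewrite rhoE ffunE mxE -eq_mulgV1.
by rewrite (inj_eq (bij_inj enumG_bij)).
Qed.

Lemma rho_inj : injective (rho enumG).
Proof.
have [f fK Kf] := enumG_bij => x y /matrixP eq_xy; apply/ffunP=> g.
by have := eq_xy (f g) (f 1%g); rewrite !rhoE !Kf invg1 mulg1.
Qed.

Lemma tilde1 n : tilde enumG (1%:M : 'M_n) = 1%:M.
Proof.
rewrite -mxdiagZ; apply: eq_mxblock => i j; rewrite mxE.
case: eqVneq => _; first by rewrite conform_mx_id rho1.
by apply/matrixP=> k l; rewrite rhoE !mxE ffunE.
Qed.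

Lemma tildeM n (A B : 'M[ZG[gT]]_n) :
  tilde enumG (A *m B) = tilde enumG A *m tilde enumG B.
Proof.
rewrite mul_mxblock; apply: eq_mxblock => i j; apply/matrixP=> k l.
rewrite rhoE mxE sum_ffunE summxE; apply: eq_bigr => h _.
by rewrite -rhoM rhoE.
Qed.

Lemma tildeX n (A : 'M[ZG[gT]]_n) k : tilde enumG (A ^+ k) = tilde enumG A ^+ k.
Proof. by elim: k => [|k IHk]; rewrite ?tilde1 // !exprS tildeM IHk. Qed.

Lemma tilde_inj n : injective (@tilde gT enumG n).
Proof.
move=> A B; rewrite /tilde => /eq_mxblockP eqAB; apply/matrixP=> i j.
exact: rho_inj (eqAB i j).
Qed.

(** * Trace recurrences *)

(** Cayley-Hamilton for tilde A, pulled back along the injective morphism. *)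
Lemma char_poly_tilde_annihilates n (A : 'M[ZG[gT]]_n) :
  \sum_(i < (\sum_(i < n) #|gT|).+1)
     A ^+ i *~ (char_poly (tilde enumG A))`_i = 0.
Proof.
apply: tilde_inj; rewrite [RHS]raddf0 -(Cayley_Hamilton_sum (tilde enumG A)).
rewrite raddf_sum; apply: eq_bigr => i _.
by rewrite -tildeX -[X in _ = X *: _]intz scaler_int; apply: raddfMz.
Qed.

(** Multiply the relation by A^k and apply f o tr; the leading coefficient
    is 1. *)
Lemma additive_trace_recurrence (V : zmodType) (f : {additive ZG[gT] -> V})
    n (A : 'M[ZG[gT]]_n) (N := (\sum_(i < n) #|gT|)%N) k :
  f (\tr (A ^+ (N + k))) =
  - \sum_(i < N) f (\tr (A ^+ (i + k))) *~ (char_poly (tilde enumG A))`_i.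
Proof.
have recA : \sum_(i < N) A ^+ (i + k) *~ (char_poly (tilde enumG A))`_i
              + A ^+ (N + k) = 0.
  have /monicP := char_poly_monic (tilde enumG A).
  rewrite lead_coefE size_char_poly /= => lead1.
  rewrite -[RHS](mul0r (A ^+ k)) -[in RHS](char_poly_tilde_annihilates A).
  rewrite [in RHS]big_ord_recr /= lead1 mulr1z mulrDl mulr_suml -exprD.
  by congr (_ + _); apply: eq_bigr => i _; rewrite mulrzAl -exprD.
apply/eqP; rewrite -addr_eq0 addrC; apply/eqP.
rewrite -[RHS](raddf0 f) -[in RHS](mxtrace0 _ n) -[in RHS]recA mxtraceD raddfD.
congr (_ + _).
rewrite (raddf_sum (@mxtrace _ n)) (raddf_sum f); apply: eq_bigr => i _.
by rewrite (raddfMz (@mxtrace _ n)) (raddfMz f).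
Qed.

(** Since f remembers the coefficient of the identity, the first N values fix
    the characteristic polynomial of tilde A, hence the recurrence. *)
Lemma additive_trace_determined (V : zmodType) (f : {additive ZG[gT] -> V})
    n (A B : 'M[ZG[gT]]_n) :
  (forall x y, f x = f y -> x 1%g = y 1%g) ->
  (forall k, (1 <= k <= #|gT| * n)%N -> f (\tr (A ^+ k)) = f (\tr (B ^+ k))) ->
  forall k, (1 <= k)%N -> f (\tr (A ^+ k)) = f (\tr (B ^+ k)).
Proof.
move=> f_coef1; rewrite mulnC -[X in (X * _)%N](card_ord n) -sum_nat_const.
set N := (\sum_(i in 'I_n) #|gT|)%N => trAB.
have eq_eta : char_poly (tilde enumG A) = char_poly (tilde enumG B).
  apply: char_poly_eq_mxtrace => k /trAB/f_coef1 eq1.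
  by rewrite -2!tildeX 2!mxtrace_tilde eq1.
elim/ltn_ind=> k IHk k_gt0; have [ltNk|lekN] := ltnP N k; last first.
  by rewrite trAB ?k_gt0.
(* The recurrence at k > N uses the exponents i + (k - N), all positive. *)
have -> : k = (N + (k - N))%N by rewrite subnKC // ltnW.
rewrite !additive_trace_recurrence eq_eta; congr (- _); apply: eq_bigr => i _.
rewrite IHk ?addn_gt0 ?subn_gt0 ?ltNk ?orbT //.
by rewrite -[ltnRHS](subnKC (ltnW ltNk)) ltn_add2r.
Qed.

End IntGroupRing.

Theorem propositionB3 (gT : finGroupType) (enumG : 'I_#|gT| -> gT)
    (enumG_bij : bijective enumG) :
  (forall (n : nat) (A : 'M[ZG[gT]]_n.+1),
     let eta : {poly int} := char_poly (tilde enumG A) in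
     (map_poly intr eta).[A] = 0)
  /\ (forall (n : nat) (A B : 'M[ZG[gT]]_n.+1),
        (forall k : nat, (1 <= k <= #|gT| * n.+1)%N ->
           \tr (A ^+ k) = \tr (B ^+ k)) ->
        forall k : nat, (1 <= k)%N -> \tr (A ^+ k) = \tr (B ^+ k))
  /\ (forall (n : nat) (A B : 'M[ZG[gT]]_n.+1),
        (forall k : nat, (1 <= k <= #|gT| * n.+1)%N ->
           kappa (\tr (A ^+ k)) = kappa (\tr (B ^+ k))) ->
        forall k : nat, (1 <= k)%N ->
          kappa (\tr (A ^+ k)) = kappa (\tr (B ^+ k)))
  /\ (forall (n p : nat) (A : 'M[ZG[gT]]_n) (B : 'M[ZG[gT]]_p),
        strong_shift_equiv A B ->
        forall k : nat, (1 <= k)%N ->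
          kappa (\tr (A ^+ k)) = kappa (\tr (B ^+ k))).
Proof.
split=> [n A eta|].
  rewrite (@horner_coef_wide _ (\sum_(i < n.+1) #|gT|).+1); last first.
    by rewrite (leq_trans (size_poly _ _)) // size_char_poly.
  rewrite -[RHS](char_poly_tilde_annihilates enumG_bij A).
  by apply: eq_bigr => i _; rewrite coef_map /= mulrzl.
split=> [n A B|].
  by apply: (additive_trace_determined enumG_bij (f := idfun)) => x y /= ->.
split=> [n A B|n p A B].
  apply: (additive_trace_determined enumG_bij (f := kappa (gT := gT))).
  move=> x y eq_xy.
  by rewrite -!kappa_class1 eq_xy.
exact: kappa_trace_sse.
Qed.
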